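(* Let $A$ be a finite set of positive real numbers with $|A|\geq 2$, and let $E(A)$ denote its multiplicative energy. Then $$\frac{E(A)}{\lceil\log_2|A|\rceil}\;\leq\; 4|A+A|^2.$$
   Context: For a finite set $A$ of real numbers, the multiplicative energy of $A$ is $$E(A)=\left|\{(a,b,c,d)\in A^4 : \exists\, \lambda\in\mathbb{R} \text{ with } (a,b)=(\lambda c,\lambda d)\}\right|,$$ and the sumset is $A+A=\{a+b : a,b\in A\}$. $|X|$ denotes the cardinality of a finite set $X$, and $\lceil\cdot\rceil$ is the ceiling function. *)

(* Defs.v *)
From mathcomp Require Import all_boot all_order all_algebra finmap.
From mathcomp Require Import boolp reals exp.

Set Implicit Arguments.
Unset Strict Implicit.
Unset Printing Implicit Defensive.

Import Order.TTheory GRing.Theory Num.Theory.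

Local Open Scope fset_scope.
Local Open Scope ring_scope.

(* A quadruple (a, b, c, d) of A^4 is encoded as q = (((a, b), c), d). *)
Definition mult_energy_set (R : realType) (A : {fset R}) :
    {fset R * R * R * R} :=
  [fset q in A `*` A `*` A `*` A |
    let: (a, b, c, d) := q in
    `[< exists lambda : R, (a, b) = (lambda * c, lambda * d) >]].

Definition mult_energy (R : realType) (A : {fset R}) : nat :=
  #|` mult_energy_set A|.

Definition sumset (R : realType) (A : {fset R}) : {fset R} :=
  [fset a + b | a in A, b in A].

Definition log2 (R : realType) (x : R) : R := ln x / ln 2.

(* Main.v *)
Require Import Defs.
From mathcomp Require Import all_boot all_order all_algebra finmap.
From mathcomp Require Import boolp reals exp.
From mathcomp Require Import zify ring.

(** The proof is Solymosi's geometric argument.  For a slope [l], let [r(l)] be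
    the number of points of [A * A] on the line [y = l x].  An energy quadruple
    [(a, b, c, d)] is a pair of points [(c, a)], [(d, b)] of [A * A] on one
    line through the origin, so the energy is at most the sum of [r(l) ^ 2]
    over the slopes that occur ([energy_le_lines]).

    Vector sums of points of [A * A] lie in [(A + A) * (A + A)].  For slopes
    [l < m] the sums of a point of the line of [l] and a point of the line of
    [m] are pairwise distinct, because two distinct directions are linearly
    independent, and they lie strictly between the two lines.  Hence, for
    slopes [l_1 < ... < l_k] with at least [t] points each, consecutive lines
    produce sums in disjoint open sectors, [t ^ 2] in each.  The steepest line
    has no successor; it is paired with a vertical line instead, which yields
    [t ^ 2] more sums on or above it.  Altogether
    [k * t ^ 2 <= |A + A| ^ 2] ([card_rich_slopes]).

    Grouping the slopes by the dyadic size [2 ^ j <= r(l) <= 2 ^ j.+1], each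
    group contributes at most [4 |A + A| ^ 2] to the energy ([dyadic_slopes]),
    and the indices [j < k] cover all slopes as soon as [|A| <= 2 ^ k]; the
    ceiling of [log2 |A|] is such a [k]. *)

Set Implicit Arguments.
Unset Strict Implicit.
Unset Printing Implicit Defensive.

Import Order.TTheory GRing.Theory Num.Theory.

Local Open Scope fset_scope.
Local Open Scope ring_scope.

Lemma leq_card_inj (T T' : choiceType) (f : T -> T') (X : {fset T})
    (Y : {fset T'}) :
    {in X &, injective f} -> (forall x, x \in X -> f x \in Y) ->
  (#|` X| <= #|` Y|)%N.
Proof.
move=> f_inj fXY; rewrite -(card_in_imfset imfset_key (p := mem X) f_inj).
by apply/fsubset_leq_card/fsubsetP => _ /imfsetP[x /= xX ->]; exact: fXY.
Qed.

Lemma card_fsetM (T T' : choiceType) (X : {fset T}) (Y : {fset T'}) :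
  #|` X `*` Y| = (#|` X| * #|` Y|)%N.
Proof.
rewrite card_fset_sum1 big_imfset2 /=; last by move=> [? ?] [? ?] _ _ [-> ->].
rewrite (eq_bigr (fun=> #|` Y|)) => [|x _]; last by rewrite card_fset_sum1.
by rewrite big_const_seq count_predT iter_addn_0 mulnC.
Qed.

Section Lines.
Variables (R : realType) (A : {fset R}).
Hypothesis A_gt0 : forall a : R, a \in A -> 0 < a.

(** The points of [A * A] on the line [y = l x], each given by its abscissa:
    on a line through the origin the abscissa determines the point. *)
Definition line (l : R) : {fset R} := [fset x in A | l * x \in A].

Definition slopes : {fset R} :=
  [fset q.1.1.1 / q.1.2 | q in mult_energy_set A].

Definition sector (l : R) : {fset R * R} :=
  [fset p in sumset A `*` sumset A | l * p.1 <= p.2].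

Lemma in_line l x : (x \in line l) = (x \in A) && (l * x \in A).
Proof. by rewrite !inE. Qed.

Lemma mem_sumset x y : x \in A -> y \in A -> x + y \in sumset A.
Proof. by move=> xA yA; apply/imfset2P; exists x => //; exists y. Qed.

Lemma in_sector l p : (p \in sector l) =
  [&& p.1 \in sumset A, p.2 \in sumset A & l * p.1 <= p.2].
Proof. by rewrite !inE -andbA. Qed.

Lemma sumset_gt0 u : u \in sumset A -> 0 < u.
Proof. by case/imfset2P => x /= xA [y /= yA ->]; rewrite addr_gt0 ?A_gt0. Qed.

Lemma mem_energyP a b c d : reflect
  [/\ c \in line (a / c), d \in line (a / c), a \in A & b = a / c * d]
  ((a, b, c, d) \in mult_energy_set A).
Proof.
have -> : ((a, b, c, d) \in mult_energy_set A) =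
    [&& a \in A, b \in A, c \in A, d \in A &
        `[< exists l : R, (a, b) = (l * c, l * d) >]].
  by rewrite !inE /= -!andbA.
apply: (iffP and5P).
  case=> aA bA cA dA /asboolP[l [al bl]].
  have -> : a / c = l by rewrite al mulfK // gt_eqF ?A_gt0.
  by rewrite !in_line cA dA -al -bl.
rewrite !in_line => -[/andP[cA _] /andP[dA adA] aA ->]; split => //.
by apply/asboolP; exists (a / c); rewrite divfK // gt_eqF ?A_gt0.
Qed.

Lemma slopes_gt0 l : l \in slopes -> 0 < l.
Proof.
case/imfsetP => -[[[a b] c] d] /mem_energyP[+ _ aA _] -> /=.
by rewrite in_line => /andP[cA _]; rewrite divr_gt0 ?A_gt0.
Qed.

Lemma line_slopes_gt0 l : l \in slopes -> (0 < #|` line l|)%N.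
Proof.
case/imfsetP => -[[[a b] c] d] /mem_energyP[cl _ _ _] -> /=.
by rewrite cardfs_gt0; apply/fset0Pn; exists c.
Qed.

(** Passing from the slope [m] down to [l] adds at least the open sector
    between the two lines, and this sector contains all sums of a point of one
    line and a point of the other. *)
Lemma card_sector_step l m : l < m ->
  (#|` line l| * #|` line m| + #|` sector m| <= #|` sector l|)%N.
Proof.
move=> lm.
have sub : sector m `<=` sector l.
  apply/fsubsetP => p; rewrite !in_sector => /and3P[p1 p2 le]; rewrite p1 p2.
  by apply: le_trans le; rewrite ler_pM2r ?sumset_gt0 // ltW.
rewrite -(cardfsID (sector m) (sector l)) (fsetIidPr sub) addnC leq_add2l.
rewrite -card_fsetM.
apply: (leq_card_inj (f := fun p => (p.1 + p.2, l * p.1 + m * p.2))).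
  move=> [x y] [x' y'] _ _ /= [e1 e2].
  (* [m - l] is the determinant of the two directions. *)
  have : (m - l) * (y - y') = 0.
    transitivity (l * x + m * y - (l * x' + m * y')
                  - l * (x + y - (x' + y'))); first by ring.
    by rewrite e1 e2 !subrr mulr0 subrr.
  move/eqP; rewrite mulf_eq0 !subr_eq0 (gt_eqF lm) /= => /eqP yy.
  by move: e1; rewrite yy => /addIr ->.
move=> [x y]; rewrite in_fsetM /= !in_line.
move=> /andP[/andP[xA lxA] /andP[yA myA]].
rewrite in_fsetD !in_sector /= !mem_sumset //= -ltNge !mulrDr.
by rewrite ltrD2r lerD2l !(ltr_pM2r, ler_pM2r) ?A_gt0 // lm ltW.
Qed.

(** This replaces [card_sector_step] for the steepest line.  With [m] the least
    abscissa on the line, the points [(m, l * y)], for [y] in [line l], lie on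
    a vertical line and on or above the line of slope [l], so adding them to
    its points stays in the sector. *)
Lemma card_line_le_sector l : 0 < l -> (#|` line l| ^ 2 <= #|` sector l|)%N.
Proof.
move=> l0; have [->|[x0 x0A]] := fset_0Vmem (line l).
  by rewrite cardfs0.
case: (arg_minP (fun x : line l => val x) (i0 := [` x0A]) (P := predT)) => //.
move=> [m mA] _ /= min_m.
rewrite -mulnn -card_fsetM.
apply: (leq_card_inj (f := fun p => (p.1 + m, l * p.1 + l * p.2))).
  move=> [x y] [x' y'] _ _ /= [/addIr ->] /addrI /mulfI -> //.
  by rewrite gt_eqF.
move=> [x y]; rewrite in_fsetM /= => /andP[xA yA].
have := min_m [` yA] isT; move: xA yA mA; rewrite /= !in_line.
move=> /andP[xA lxA] /andP[yA lyA] /andP[mA _] my.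
by rewrite in_sector /= !mem_sumset //= mulrDr lerD2l ler_pM2l.
Qed.

(** For increasing slopes [l :: s], [sector l] contains the open sectors between
    neighbours and the closed sector above the last line, all disjoint. *)
Lemma card_path_le_sector t l s : path <%R l s ->
    {in l :: s, forall m, 0 < m} ->
    {in l :: s, forall m, (t <= #|` line m|)%N} ->
  ((size s).+1 * t ^ 2 <= #|` sector l|)%N.
Proof.
elim: s l => [|m s IH] l /=.
  move=> _ s_gt0 s_ge; rewrite mul1n.
  apply: leq_trans (card_line_le_sector _); last by rewrite s_gt0 ?inE.
  by rewrite leq_exp2r // s_ge ?inE.
move=> /andP[lm pm] s_gt0 s_ge.
apply: leq_trans (card_sector_step lm).
rewrite mulSn -mulnn leq_add //.
  by rewrite leq_mul // s_ge // !inE eqxx ?orbT.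
by rewrite mulnn; apply: IH => // k ks; [apply: s_gt0 | apply: s_ge];
  rewrite inE ks orbT.
Qed.

Lemma card_rich_slopes t (D : {fset R}) : {in D, forall m, 0 < m} ->
    {in D, forall m, (t <= #|` line m|)%N} ->
  (#|` D| * t ^ 2 <= #|` sumset A| ^ 2)%N.
Proof.
move=> D_gt0 D_ge.
have -> : #|` D| = size (sort <=%R D) by rewrite size_sort.
have := sort_lt_sorted D; rewrite fset_uniq.
have : sort <=%R D =i D by move=> x; rewrite mem_sort.
case: (sort _ _) => [|l s] //= memD pls.
have -> : (#|` sumset A| ^ 2 = #|` sumset A `*` sumset A|)%N.
  by rewrite card_fsetM mulnn.
apply: leq_trans (fsubset_leq_card (fset_sub _ (fun p => l * p.1 <= p.2))).
apply: card_path_le_sector => // m; rewrite memD; [exact: D_gt0 | exact: D_ge].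
Qed.

(** The quadruples with [a / c = l] are determined by [c] and [d], both
    abscissae of points on the line of slope [l]. *)
Lemma energy_le_lines :
  (mult_energy A <= \sum_(l <- slopes) #|` line l| ^ 2)%N.
Proof.
rewrite /mult_energy card_fset_sum1.
rewrite (partition_big_imfset _ (fun q => q.1.1.1 / q.1.2)) /=.
apply: leq_sum => l _; rewrite big_fset_condE -card_fset_sum1.
rewrite -mulnn -card_fsetM.
apply: (leq_card_inj (f := fun q => (q.1.2, q.2))).
  move=> [[[a b] c] d] [[[a' b'] c'] d'].
  rewrite in_fset inE /= => /andP[/mem_energyP[cl _ _ ->] /eqP al].
  rewrite in_fset inE /= => /andP[/mem_energyP[_ _ _ ->] /eqP al'] [ec ed].
  move: cl; rewrite in_line => /andP[/A_gt0 c0 _].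
  suff -> : a = a' by rewrite -ec ed.
  by apply: (mulIf (x := c^-1)); rewrite ?invr_eq0 ?gt_eqF // al ec al'.
move=> [[[a b] c] d]; rewrite in_fset inE in_fsetM /=.
by move=> /andP[/mem_energyP[cl dl _ _] /eqP <-]; rewrite cl.
Qed.

(** Up to the factor 4 between the squares of its two ends, a dyadic class of
    lines has constant size, and [card_rich_slopes] applies at its lower end. *)
Lemma dyadic_slopes j :
  (\sum_(l <- slopes | 2 ^ j <= #|` line l| <= 2 ^ j.+1) #|` line l| ^ 2
     <= 4 * #|` sumset A| ^ 2)%N.
Proof.
rewrite big_fset_condE /=; set D := [fset _ in _ | _].
have inD l : l \in D ->
    l \in slopes /\ (2 ^ j <= #|` line l| <= 2 ^ j.+1)%N.
  by rewrite in_fset inE => /andP[].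
apply: (@leq_trans (\sum_(l <- D) (2 * 2 ^ j) ^ 2)%N).
  rewrite !big_seq; apply: leq_sum => l /inD[_ /andP[_]].
  by rewrite expnS leq_exp2r.
rewrite big_const_seq count_predT iter_addn_0 expnMn mulnAC -mulnA.
rewrite leq_mul2l /=.
by apply: card_rich_slopes => l /inD[lS /andP[? _]] //; apply: slopes_gt0.
Qed.

(** Closed dyadic intervals make [k] classes enough, even when a line has
    exactly [2 ^ k] points; a line in two classes is counted twice, which an
    upper bound can afford. *)
Lemma energy_le_pow2 k : (0 < k)%N -> (#|` A| <= 2 ^ k)%N ->
  (mult_energy A <= k * (4 * #|` sumset A| ^ 2))%N.
Proof.
move=> k_gt0 Ak; apply: leq_trans energy_le_lines _.
have -> : (k * (4 * #|` sumset A| ^ 2)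
    = \sum_(j < k) 4 * #|` sumset A| ^ 2)%N.
  by rewrite big_const_ord iter_addn_0 mulnC.
apply: leq_trans (leq_sum _ (fun (j : 'I_k) _ => dyadic_slopes j)).
rewrite (exchange_big_dep predT) //= big_seq [leqRHS]big_seq.
apply: leq_sum => l lS; have r_gt0 := line_slopes_gt0 lS.
set r := #|` line l| in r_gt0 *.
(* A line with [r > 1] points is in the class [(up_log 2 r).-1]; the truncated
   predecessor also puts the lines with a single point in class 0. *)
have rk : (up_log 2 r <= k)%N.
  apply: up_log_min => //; apply: leq_trans Ak.
  exact/fsubset_leq_card/fset_sub.
have jk : ((up_log 2 r).-1 < k)%N by lia.
rewrite (bigD1 (Ordinal jk)) /=; first exact: leq_addr.
have [r1|r_gt1] := leqP r 1%N.
  by have -> : r = 1%N by [lia]; rewrite up_log1.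
rewrite (ltnW (up_log_gtn _ _)) //= prednK ?up_log_gt0 //.
exact: up_logP.
Qed.

End Lines.

Lemma ceil_log2_nat (R : realType) (n : nat) : (2 <= n)%N ->
  exists2 k, (0 < k)%N &
    Num.ceil (log2 (n%:R : R)) = k%:Z /\ (n <= 2 ^ k)%N.
Proof.
move=> n2.
have ln2_gt0 : 0 < ln 2 :> R by rewrite ln_gt0 // ltr1n.
have n_gt0 : 0 < n%:R :> R by rewrite ltr0n; lia.
have : 0 < Num.ceil (log2 (n%:R : R)).
  by rewrite ceil_gt0 divr_gt0 // ln_gt0 // ltr1n.
have := ceil_ge (log2 (n%:R : R)).
case: (Num.ceil _) => // k le_k k_gt0; exists k => //; split => //.
rewrite -(ler_nat R) natrX -ler_ln ?posrE ?exprn_gt0 //.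
by rewrite lnXn // -[_ *+ k]mulr_natl -ler_pdivrMr.
Qed.

Theorem lemma2p3 (R : realType) (A : {fset R})
    (A_gt0 : forall a : R, a \in A -> 0 < a)
    (A_ge2 : (2 <= #|` A|)%N) :
  (mult_energy A)%:R / (Num.ceil (log2 (#|` A|%:R : R)))%:~R
    <= 4 * (#|` sumset A|%:R) ^+ 2 :> R.
Proof.
have [k k_gt0 [-> Ak]] := ceil_log2_nat R A_ge2.
rewrite ler_pdivrMr ?ltr0n // -natrX -!natrM ler_nat mulnC.
exact: energy_le_pow2.
Qed.
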